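(* For each natural number $n\geq 2$, the set ${\rm Fall}(KG(n,2))$ of all natural numbers $k$ for which the Kneser graph $KG(n,2)$ admits a fall coloring with exactly $k$ colors is given by $${\rm Fall}(KG(n,2))=\begin{cases} \{1\} & \text{if } n=2 \text{ or } n=3,\\ \{2\} & \text{if } n=4,\\ \left\{\frac{n(n-1)}{6}\right\} & \text{if } n\geq 5 \text{ and } n\equiv 1 \text{ or } 3 \pmod 6,\\ \left\{\frac{(n-1)(n-2)}{6}+1\right\} & \text{if } n\geq 5 \text{ and } n\equiv 2 \text{ or } 4 \pmod 6,\\ \emptyset & \text{if } n\geq 5 \text{ and } n\equiv 0 \text{ or } 5 \pmod 6. \end{cases}$$
   Context: All graphs are simple, with nonempty finite vertex sets. For a positive integer $k$, $[k]=\{1,2,\dots,k\}$. For $n\geq m$, $\binom{[n]}{m}$ denotes the set of all $m$-element subsets of $[n]$, and the Kneser graph $KG(n,m)$ has vertex set $\binom{[n]}{m}$, with $A$ adjacent to $B$ if and only if $A\cap B=\emptyset$. A coloring of a graph $G$ is a function $f:V(G)\to C$ such that for each $c\in C$ the set $f^{-1}(c)$ is independent; the elements of $C$ are called colors. A vertex $v$ is b-dominating with respect to $f$ if $f(N[v])=C$, where $N[v]$ is the closed neighborhood of $v$ (the set consisting of $v$ and all its neighbors), i.e. $v$ sees all colors on its closed neighborhood. The coloring $f$ is a fall coloring of $G$ if all vertices of $G$ are b-dominating with respect to $f$. ${\rm Fall}(G)$ denotes the set of all natural numbers $k$ for which $G$ admits a fall coloring $f:V(G)\to C$ with $|C|=k$.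 *)

(* Defs.v *)
From mathcomp Require Import classical_sets.
From mathcomp Require Import all_boot.

Set Implicit Arguments.
Unset Strict Implicit.
Unset Printing Implicit Defensive.

(* A finite simple graph is given by its vertex type T : finType and its
   adjacency relation e : rel T, meant to be symmetric and irreflexive. *)

Section FallColoring.
Variables (T : finType) (e : rel T).

Definition closed_neigh (v : T) : {set T} := [set w | (w == v) || e v w].

Definition independent (S : {set T}) : Prop :=
  forall u v : T, u \in S -> v \in S -> ~~ e u v.

Definition coloring (C : finType) (f : T -> C) : Prop :=
  forall c : C, independent [set v | f v == c].

Definition b_dominating (C : finType) (f : T -> C) (v : T) : Prop :=
  f @: closed_neigh v = [set: C].

Definition fall_coloring (C : finType) (f : T -> C) : Prop :=
  coloring f /\ forall v : T, b_dominating f v.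

Definition Fall : set nat :=
  fun k => exists (C : finType) (f : T -> C), #|C| = k /\ fall_coloring f.

End FallColoring.

(* The ground set [n] = {1, ..., n} is represented by 'I_n = {0, ..., n-1}. *)
Definition kneser_vertex (n m : nat) : finType := {A : {set 'I_n} | #|A| == m}.

Definition kneser (n m : nat) : rel (kneser_vertex n m) :=
  fun A B => [disjoint val A & val B].
Arguments kneser n m : clear implicits.

(* For 0 < m <= n, [kneser n m] is a simple graph with at least one vertex.
   For m = 0 irreflexivity fails, the empty set being disjoint from itself. *)
Lemma kneser_sym n m : symmetric (kneser n m).
Proof. by move=> A B; rewrite /kneser disjoint_sym. Qed.

Lemma kneser_irrefl n m : 0 < m -> irreflexive (kneser n m).
Proof.
move=> m0 A; apply/negbTE; rewrite /kneser -setI_eq0 setIid -cards_eq0.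
by rewrite (eqP (valP A)) -lt0n.
Qed.

Lemma card_kneser_vertex n m : #|kneser_vertex n m| = 'C(n, m).
Proof. by rewrite card_sig -cardsE card_draws card_ord. Qed.

(* Main.v *)
Require Import Defs.
From mathcomp Require Import all_boot.
From mathcomp Require Import ssralg zmodp zify.

Set Implicit Arguments.
Unset Strict Implicit.
Unset Printing Implicit Defensive.

(** In a fall coloring every color class is an independent set that dominates
    the graph, i.e. a maximal independent set; conversely a partition of the
    vertices into maximal independent sets is a fall coloring. The vertices of
    KG(n,2) are the edges of the complete graph on n points, and its independent
    sets are the families of pairwise meeting edges, so a maximal one is either
    a full star (all edges through a point) or a triangle ([color_classP]). Thus
    a fall coloring of KG(n,2) is a decomposition of the complete graph into
    triangles and stars. Two stars share an edge, so there is at most one star: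
    the triangles form a Steiner triple system on all n points, or on the n - 1
    points other than the center of the star.

    Necessity ([fall_color_count]) is double counting. At a point other than
    the center of the star, each triangle uses 0 or 2 of the n - 1 edges and the
    star uses 1; this gives the parity of n. Counting ordered pairs of distinct
    points, each triangle takes 6 and the star 2(n - 1); this gives the number
    of colors, and with the parity it excludes n congruent to 0 or 5 modulo 6.

    Sufficiency needs Steiner triple systems of every order congruent to 1 or 3
    modulo 6 ([steiner_exists]). They are handled as Steiner quasigroups: the
    product of x and y is the third point of the block through x and y. The
    constructions of Bose (order 6m + 3) and Skolem (order 6m + 1) are both
    instances of one product on Q * Z/3, with a point at infinity in the second
    case, where Q is a commutative quasigroup. Coloring an edge by its block,
    and giving a single color to the edges through the possible extra point,
    yields a fall coloring ([Fall_of_steiner]).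

    The argument holds for every n >= 2: for n = 2, 3, 4 the formulas of the
    congruence classes give 1, 1 and 2. *)

(** * Color classes of a fall coloring are stars and triangles *)

Lemma edgeP n (x y : 'I_n) : x != y -> {A : kneser_vertex n 2 | val A = [set x; y]}.
Proof.
move=> xy; have c2 : #|[set x; y]| == 2 by rewrite cards2 xy.
by exists (exist _ [set x; y] c2).
Qed.

Section NecessaryCounts.
Variables (n : nat) (C : finType) (f : kneser_vertex n 2 -> C).
Hypotheses (n_ge2 : 2 <= n) (fall_f : fall_coloring (kneser n 2) f).
Implicit Types (A B : kneser_vertex n 2) (x y v : 'I_n) (S : {set 'I_n}) (c : C).

Lemma same_color_meet A B :
  f A = f B -> exists2 x, x \in val A & x \in val B.
Proof.
move=> fAB; have [col _] := fall_f.
have /(_ A B) := col (f B); rewrite !inE fAB eqxx => /(_ isT isT).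
by rewrite /kneser -setI_eq0 => /set0Pn[x /setIP[xA xB]]; exists x.
Qed.

Lemma color_disjoint A c :
  f A <> c -> exists2 B, f B = c & [disjoint val A & val B].
Proof.
move=> fA; have [_ /(_ A) dom] := fall_f.
have /imsetP[B] : c \in f @: closed_neigh (kneser n 2) A by rewrite dom inE.
rewrite inE => /orP[/eqP-> fAc|dAB ->]; last by exists B.
by case: fA.
Qed.

(** Maximality of the color classes: an edge that meets all the edges of color
    [c] has no neighbor of color [c], so it must have color [c] itself. *)
Lemma meet_color A c :
  (forall B, f B = c -> exists2 x, x \in val A & x \in val B) -> f A = c.
Proof.
move=> mA; apply/eqP; apply/negPn/negP => /eqP /color_disjoint[B fB].
have [x xA xB] := mA B fB.
by rewrite -setI_eq0 => /eqP/setP/(_ x); rewrite !inE xA xB.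
Qed.

Lemma pair_other A x : x \in val A -> exists2 y, x != y & val A = [set x; y].
Proof.
move=> xA; have /cards2P[a [b [ab Aab]]] := valP A.
move: xA; rewrite Aab !inE => /orP[]/eqP->; first by exists b.
by exists a; rewrite 1?eq_sym // setUC.
Qed.

Lemma color_nonempty c : exists A, f A = c.
Proof.
have [A _] := @edgeP _ (Ordinal (ltnW n_ge2)) (Ordinal n_ge2) isT.
case: (eqVneq (f A) c) => [|/eqP /color_disjoint[B]]; first by exists A.
by exists B.
Qed.

Definition star_class c v := forall A, f A = c <-> v \in val A.
Definition triangle_class c S :=
  #|S| = 3 /\ forall A, f A = c <-> val A \subset S.

(** If the edges of color [c] have a common point, they form a full star by
    maximality. Otherwise take an edge ab of color [c]; some edge of color [c]
    misses a, hence is bd, and some edge misses b, hence is ad. An edge that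
    meets ab, bd and ad lies inside {a,b,d}. *)
Lemma color_classP c : (exists v, star_class c v) \/ (exists S, triangle_class c S).
Proof.
have [/existsP[v /forallP cv]|/existsPn nov] :=
  boolP [exists v, [forall A, (f A == c) ==> (v \in val A)]].
  left; exists v => A; split=> [fA|vA].
    by have /implyP := cv A; apply; apply/eqP.
  apply: meet_color => B fB; exists v => //.
  by have /implyP := cv B; apply; apply/eqP.
have miss v : exists2 A, f A = c & v \notin val A.
  have /forallPn[A] := nov v; rewrite negb_imply => /andP[/eqP fA vA].
  by exists A.
right; have [A fA] := color_nonempty c.
have [a aA] : exists a, a \in val A.
  by apply/set0Pn; rewrite -card_gt0 (eqP (valP A)).
have [b ab EA] := pair_other aA.
have [B fB aB] := miss a; have [D fD bD] := miss b.
have bB : b \in val B.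
  have [|x] := @same_color_meet A B; first by rewrite fA.
  by rewrite EA !inE => /orP[]/eqP-> //; rewrite (negPf aB).
have aD : a \in val D.
  have [|x] := @same_color_meet A D; first by rewrite fA.
  by rewrite EA !inE => /orP[]/eqP-> //; rewrite (negPf bD).
have [d bd EB] := pair_other bB.
have dD : d \in val D.
  have [|x] := @same_color_meet B D; first by rewrite fB.
  by rewrite EB !inE => /orP[]/eqP-> //; rewrite (negPf bD).
have ad : a != d by move: aB; rewrite EB !inE negb_or => /andP[].
have ED : val D = [set a; d].
  apply/eqP; rewrite eq_sym eqEcard (eqP (valP D)) cards2 ad andbT.
  by apply/subsetP=> x; rewrite !inE => /orP[]/eqP->.
have S3 : #|[set a; b; d]| = 3.
  by rewrite setUC !cardsU1 cards1 !inE !(eq_sym d) (negPf ab) (negPf ad)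
             (negPf bd).
(* If p in E is outside {a,b,d}, the other end of E is on ab, bd and ad. *)
have subS E : f E = c -> val E \subset [set a; b; d].
  move=> fE; apply/subsetP=> p pE; apply: contraT => pS.
  have [q _ EE] := pair_other pE.
  have qX X : f X = c -> val X \subset [set a; b; d] -> q \in val X.
    move=> fX XS; have [|x] := @same_color_meet E X; first by rewrite fE.
    rewrite EE !inE => /orP[]/eqP-> // pX.
    by rewrite (subsetP XS _ pX) in pS.
  have sub2 (x y : 'I_n) : x \in [set a; b; d] -> y \in [set a; b; d] ->
    [set x; y] \subset [set a; b; d] by move=> xS yS; rewrite subUset !sub1set xS.
  have := qX A fA; have := qX B fB; have := qX D fD.
  rewrite EA EB ED !sub2 ?inE ?eqxx ?orbT // => /(_ isT) qD /(_ isT) qB /(_ isT) qA.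
  case/orP: qA qB qD => /eqP->; first by rewrite (negPf ab) (negPf ad).
  by rewrite (eq_sym b a) (negPf ab) (negPf bd).
exists [set a; b; d]; split=> // E; split=> [/subS//|ES].
apply: meet_color => X /subS XS; apply/exists_inP.
rewrite -[X in is_true X]negbK; apply/negP=> /exists_inPn EX.
(* Two disjoint edges do not fit in three points. *)
have EX0 : val E :&: val X = set0.
  by apply/setP=> x; rewrite !inE; apply/negP=> /andP[/EX/negP].
have : #|val E :|: val X| <= 3 by rewrite -S3 subset_leq_card // subUset ES.
by have := cardsUI (val E) (val X); rewrite EX0 cards0 (eqP (valP E)) (eqP (valP X)); lia.
Qed.

(** * Counting the edges of each color *)

(** The coloring as a partial function of two points, undefined on the
    diagonal; counting ordered pairs of points avoids binomial coefficients. *)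
Definition pair_color x y : option C := omap f (insub [set x; y]).

Lemma pair_color_id x : pair_color x x = None.
Proof. by rewrite /pair_color insubN // setUid cards1. Qed.

Lemma pair_colorE x y A : val A = [set x; y] -> pair_color x y = Some (f A).
Proof. by rewrite /pair_color => <-; rewrite valK. Qed.

Lemma pair_color_triangle c S : triangle_class c S ->
  forall x y, (pair_color x y == Some c) = [&& x != y, x \in S & y \in S].
Proof.
move=> [_ cS] x y; have [<-|xy] /= := eqVneq x y; first by rewrite pair_color_id.
have [A EA] := edgeP xy; rewrite (pair_colorE EA) eqE /=.
by apply/eqP/idP=> [/cS|H]; [|apply/cS]; rewrite EA subUset !sub1set.
Qed.

Lemma pair_color_star c v : star_class c v ->
  forall x y, (pair_color x y == Some c) = (x != y) && ((x == v) || (y == v)).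
Proof.
move=> cv x y; have [<-|xy] /= := eqVneq x y; first by rewrite pair_color_id.
have [A EA] := edgeP xy; rewrite (pair_colorE EA) eqE /=.
by apply/eqP/idP=> [/cv|H]; [|apply/cv]; rewrite EA !inE !(eq_sym v).
Qed.

Definition color_deg c x := #|[set y | pair_color x y == Some c]|.

Lemma sum_color_deg x : \sum_c color_deg c x = n.-1.
Proof.
transitivity (\sum_(y | y != x) 1); last first.
  by rewrite sum1_card cardC1 card_ord.
pose g c y := (pair_color x y == Some c : nat).
transitivity (\sum_c \sum_y g c y).
  apply: eq_bigr => c _; rewrite /color_deg -sum1_card big_mkcond.
  by apply: eq_bigr => y _; rewrite inE /g; case: eqP.
rewrite exchange_big /= [RHS]big_mkcond; apply: eq_bigr => y _; rewrite /g eq_sym.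
have [<-|xy] := eqVneq x y; first by rewrite pair_color_id big1.
have [A EA] := edgeP xy; rewrite (pair_colorE EA) (bigD1 (f A)) //= eqxx big1 // => c.
by rewrite (inj_eq Some_inj) eq_sym => /negPf->.
Qed.

Lemma triangle_deg c S x :
  triangle_class c S -> color_deg c x = (x \in S).*2.
Proof.
move=> cS; rewrite /color_deg; under eq_finset => y do rewrite (pair_color_triangle cS).
case: (boolP (x \in S)) => xS /=; last first.
  by apply/eqP; rewrite cards_eq0; apply/eqP/setP=> y; rewrite !inE andbF.
transitivity #|S :\ x|.
  by apply: eq_card => y; rewrite !inE eq_sym.
by have := cardsD1 x S; rewrite xS (proj1 cS) => -[].
Qed.

Lemma star_deg c v x :
  star_class c v -> color_deg c x = if x == v then n.-1 else 1.
Proof.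
move=> cv; rewrite /color_deg; under eq_finset => y do rewrite (pair_color_star cv).
have [->|xv] := eqVneq x v.
  rewrite -[in RHS](card_ord n) -(cardC1 v); apply: eq_card => y.
  by rewrite !inE andbT eq_sym.
rewrite -(cards1 v); apply: eq_card => y; rewrite !inE /=.
by have [->|//] := eqVneq y v; rewrite ?andbF // xv.
Qed.

Lemma sum_triangle_deg c S : triangle_class c S -> \sum_x color_deg c x = 6.
Proof.
move=> cS; under eq_bigr => x _ do rewrite (triangle_deg x cS) -muln2.
rewrite -big_distrl /= (_ : \sum_x _ = 3) // -(proj1 cS) -sum1_card [RHS]big_mkcond.
by apply: eq_bigr => x _; case: (x \in S).
Qed.

Lemma sum_star_deg c v : star_class c v -> \sum_x color_deg c x = (n.-1).*2.
Proof.
move=> cv; rewrite (bigD1 v) //= (star_deg _ cv) eqxx.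
rewrite (eq_bigr (fun=> 1)) => [|x /negPf xv]; last by rewrite (star_deg _ cv) xv.
by rewrite sum1_card cardC1 card_ord addnn.
Qed.

(** Stars centered at v and v' share the edge vv' (or any edge of the star when
    v = v'). *)
Lemma star_class_uniq c c' v v' : star_class c v -> star_class c' v' -> c = c'.
Proof.
move=> cv cv'.
have [A [vA v'A]] : exists A, v \in val A /\ v' \in val A.
  have [<-|vv'] := eqVneq v v'.
    have [A /cv vA] := color_nonempty c; by exists A.
  by have [A EA] := edgeP vv'; exists A; rewrite EA !inE !eqxx orbT.
by have /cv <- := vA; have /cv' := v'A.
Qed.

Lemma sum_sum_color_deg : \sum_c \sum_x color_deg c x = n * n.-1.
Proof.
rewrite exchange_big /=; under eq_bigr => x _ do rewrite sum_color_deg.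
by rewrite sum_nat_const card_ord.
Qed.

(** The two cases are: no star, and exactly one star. *)
Lemma fall_color_count :
  (odd n /\ 6 * #|C| = n * n.-1) \/
  (~~ odd n /\ 6 * #|C|.-1 = n.-1 * n.-2 /\ 0 < #|C|).
Proof.
have x0 : 'I_n := Ordinal n_ge2.
have [/existsP[c0 c0P]|/existsPn noStar] :=
  boolP [exists c, [exists v, [forall A, (f A == c) == (v \in val A)]]].
  have [v0 c0v] : exists v, star_class c0 v.
    case/existsP: c0P => v /forallP vP; exists v => A.
    by rewrite -(eqP (vP A)); split=> /eqP.
  have tri c : c != c0 -> exists S, triangle_class c S.
    by case: (color_classP c) => [[v /star_class_uniq/(_ c0v)->]|//]; rewrite eqxx.
  right; split.
    have [x xv0] : exists x, x != v0.
      apply/existsP; rewrite -[X in is_true X]negbK negb_exists.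
      apply/negP=> /forallP allv; have := cardC1 v0; rewrite card_ord eq_card0.
        by move=> E; have : n.-1 = 0 by []; lia.
      by move=> x; rewrite !inE; have := allv x; rewrite negbK => ->.
    have := sum_color_deg x; rewrite (bigD1 c0) //= (star_deg _ c0v) (negPf xv0).
    have -> : \sum_(c | c != c0) color_deg c x =
              (\sum_(c | c != c0) (color_deg c x)./2) * 2.
      rewrite big_distrl /=; apply: eq_bigr => c /tri[S cS].
      by rewrite (triangle_deg _ cS) doubleK muln2.
    move: (\sum_(c | _) _) => s E.
    have -> : n = s.+1.*2 by lia.
    by rewrite odd_double.
  have C0 : 0 < #|C| by apply/card_gt0P; exists c0.
  split=> //; have := sum_sum_color_deg; rewrite (bigD1 c0) //= (sum_star_deg c0v).
  rewrite (eq_bigr (fun=> 6)) => [|c /tri[S /sum_triangle_deg //]].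
  rewrite sum_nat_const cardC1.
  have [p Ep] : exists p, n = p.+2 by exists n.-2; lia.
  by rewrite [in _ + _]Ep [in X in _ = X -> _]Ep [in X in _ -> X]Ep /=; nia.
have tri c : exists S, triangle_class c S.
  case: (color_classP c) => [[v cv]|//]; have /existsPn/(_ v)/negP[] := noStar c.
  by apply/forallP=> A; apply/eqP; apply/eqP/idP=> /cv.
left; split.
  have := sum_color_deg x0.
  have -> : \sum_c color_deg c x0 = (\sum_c (color_deg c x0)./2) * 2.
    rewrite big_distrl /=; apply: eq_bigr => c _; have [S cS] := tri c.
    by rewrite (triangle_deg _ cS) doubleK muln2.
  move: (\sum_c _) => s E.
  have -> : n = s.*2.+1 by lia.
  by rewrite /= odd_double.
rewrite -sum_sum_color_deg (eq_bigr (fun=> 6)) => [|c _]; last first.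
  by have [S /sum_triangle_deg] := tri c.
by rewrite sum_nat_const mulnC.
Qed.

End NecessaryCounts.

(** * Steiner quasigroups give fall colorings *)

(** Restricting the set of colors to the image of [c] makes every color used,
    so that it suffices to compare the fibers of [c]. *)
Lemma Fall_of_fibers n (L : finType) (c : kneser_vertex n 2 -> L) :
    (forall A B, c A = c B -> ~~ [disjoint val A & val B]) ->
    (forall A B, c A <> c B ->
       exists2 B', c B' = c B & [disjoint val A & val B']) ->
  exists k, Fall (kneser n 2) k.
Proof.
move=> meet dom.
pose f A : {l | l \in codom c} := exist _ (c A) (codom_f c A).
exists #|{: {l | l \in codom c}}|, _, f; split=> //; split.
  by move=> l A B; rewrite !inE => /eqP<- /eqP[/esym/meet].
move=> A; apply/setP=> -[l lc]; have /codomP[B lB] := lc; rewrite inE; apply/imsetP.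
have [eAB|/eqP/dom[B' cB' dAB']] := eqVneq (c A) (c B).
  by exists A; [rewrite inE eqxx | apply: val_inj; rewrite /= lB eAB].
by exists B'; [rewrite inE /kneser dAB' orbT | apply: val_inj; rewrite /= lB cB'].
Qed.

(** The algebraic form of a Steiner triple system on [P]: for x <> y the element
    [t x y] is the third point of the block through x and y. *)
Definition steiner_quasigroup (P : finType) (t : P -> P -> P) :=
  [/\ commutative t, idempotent_op t & forall x, involutive (t x)].

Section Blocks.
Variables (P : finType) (t : P -> P -> P).
Hypothesis sqg_t : steiner_quasigroup t.
Implicit Types (x y : P) (A B : {set P}).

(** For a pair {x,y} this is the block {x, y, t x y} through x and y
    ([block_pair]): idempotency brings in x and y themselves. *)
Definition block A := t @2: (A, A).

Lemma block_pair x y : block [set x; y] = [set x; y; t x y].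
Proof.
have [tC tI _] := sqg_t; apply/setP=> z; apply/imset2P/idP.
  move=> [a b]; rewrite !inE => /orP[]/eqP-> /orP[]/eqP-> ->;
  by rewrite ?tI ?(tC y x) !eqxx ?orbT.
rewrite !inE => /orP[/orP[]|] /eqP->.
- by exists x x; rewrite ?inE ?eqxx ?tI.
- by exists y y; rewrite ?inE ?eqxx ?orbT ?tI.
- by exists x y; rewrite ?inE ?eqxx ?orbT.
Qed.

Lemma card_block A : #|A| = 2 -> #|block A| = 3.
Proof.
have [tC tI tK] := sqg_t => /eqP/cards2P[x [y [xy ->]]].
have tx a b : a != b -> t a b != a.
  by apply: contra => /eqP E; rewrite -(tK a b) E tI.
rewrite block_pair setUC !cardsU1 cards1 !inE (negPf (tx _ _ xy)) xy.
by rewrite tC eq_sym in xy *; rewrite (negPf (tx _ _ xy)).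
Qed.

Lemma sub_block A : A \subset block A.
Proof.
have [_ tI _] := sqg_t; apply/subsetP=> x xA.
by apply/imset2P; exists x x; rewrite ?tI.
Qed.

Lemma block_uniq A B : #|A| = 2 -> #|B| = 2 -> B \subset block A -> block B = block A.
Proof.
have [tC tI tK] := sqg_t.
move=> /[dup] /card_block cA + /[dup] /card_block cB.
move=> /eqP/cards2P[x [y [xy EA]]] /eqP/cards2P[u [v [uv EB]]] BA.
apply/eqP; rewrite eqEcard cA cB leqnn andbT EB block_pair subUset sub1set -EB BA EA.
move: uv BA; rewrite EB EA block_pair subUset !sub1set !inE => uv /andP[].
have K1 := tK x y; have K2 := tK y x; have Kx := tC y x.
have K3 := tC (t x y) x; have K4 := tC (t x y) y; rewrite Kx in K2.
by do 2![case/orP=> [/orP[]|] /eqP ?]; subst; rewrite ?eqxx // in uv *;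
   rewrite ?(K3, K4) ?(K1, K2, Kx) ?eqxx ?orbT.
Qed.

End Blocks.

Section BlockColoring.
Variables (n : nat) (P : finType) (t : P -> P -> P) (h : P -> 'I_n).
Hypotheses (sqg_t : steiner_quasigroup t) (h_inj : injective h) (card_P : n <= #|P|.+1).
Implicit Types (A B : kneser_vertex n 2) (S : {set P}).

(** When [h] misses a point, the edges through that point form the star and get
    the color [set0], which is the image of no block. *)
Definition block_color A : {set 'I_n} :=
  let S : {set 'I_n} := val A in
  if S \subset codom h then h @: block t (h @^-1: S) else set0.

Lemma codom_sub A : val A \subset codom h ->
  exists2 S : {set P}, #|S| = 2 & val A = h @: S.
Proof.
move=> Ah; suff EA : val A = h @: (h @^-1: val A).
  by exists (h @^-1: val A); rewrite // -(card_imset _ h_inj) -EA (eqP (valP A)).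
apply/setP=> i; apply/idP/imsetP=> [iA|[x + ->]]; last by rewrite inE.
by have /codomP[x Ei] := subsetP Ah i iA; exists x; rewrite // inE -Ei.
Qed.

Lemma block_colorE A S : val A = h @: S -> block_color A = h @: block t S.
Proof.
move=> EA; rewrite /block_color EA ifT; last first.
  by apply/subsetP=> _ /imsetP[x _ ->]; apply: codom_f.
congr (_ @: block t _); apply/setP=> x; rewrite inE mem_imset //.
Qed.

Lemma block_color0 A i : i \in val A -> i \notin codom h -> block_color A = set0.
Proof.
by move=> iA ih; rewrite /block_color ifN //; apply: contra ih => /subsetP; apply.
Qed.

Lemma codom_missing i j : i \notin codom h -> j \notin codom h -> i = j.
Proof.
move=> ih jh; apply/eqP; apply: contraT => ij.
have U : uniq [:: i, j & codom h].
  by rewrite /= inE negb_or ij ih jh map_inj_uniq // enum_uniq.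
have := max_card (mem [:: i, j & codom h]).
by rewrite (card_uniqP U) card_ord /= size_codom; lia.
Qed.

(** Two edges in one block meet because the block has only three points. Two
    edges of the star meet because [h] misses at most one point. *)
Lemma block_color_meet A B :
  block_color A = block_color B -> ~~ [disjoint val A & val B].
Proof.
have nonempty S : #|S| = 2 -> h @: block t S <> set0.
  move=> /(card_block sqg_t) c3 /eqP; rewrite -cards_eq0 card_imset //; lia.
have [|/subsetPn[i iA ih]] := boolP (val A \subset codom h);
have [|/subsetPn[j jB jh]] := boolP (val B \subset codom h).
- move=> /codom_sub[T cT EB] /codom_sub[S cS EA].
  rewrite (block_colorE EA) (block_colorE EB) => /(imset_inj h_inj) ST.
  rewrite EA EB -setI_eq0 -imsetI; last by move=> x y _ _ /h_inj.
  rewrite -cards_eq0 card_imset //.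
  have : #|S :|: T| <= #|block t S|.
    by rewrite subset_leq_card // subUset {2}ST !sub_block.
  rewrite (card_block sqg_t cS); have := cardsUI S T; lia.
- move=> /codom_sub[S cS EA].
  by rewrite (block_colorE EA) (block_color0 jB jh) => /nonempty-/(_ cS).
- move=> /codom_sub[T cT EB].
  by rewrite (block_colorE EB) (block_color0 iA ih) => /esym/nonempty-/(_ cT).
- move=> _; apply/pred0Pn; exists i.
  by rewrite /= iA (codom_missing ih jh).
Qed.

(** An edge A outside a block has at most one point in it, since a pair lies in
    a single block; two other points of the block span the required edge.
    For an edge A off the star, the block of A has a third point z, and the edge
    from z to the center of the star is disjoint from A. *)
Lemma block_color_dom A B : block_color A <> block_color B ->
  exists2 B', block_color B' = block_color B & [disjoint val A & val B'].
Proof.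
have [|/subsetPn[p pB ph]] := boolP (val B \subset codom h).
  move=> /codom_sub[T cT EB]; rewrite (block_colorE EB) => neqAB.
  have : 1 < #|(h @: block t T) :\: val A|.
    rewrite ltnNge; apply/negP=> small; apply: neqAB.
    have AT : val A \subset h @: block t T.
      apply/setIidPr/eqP; rewrite eqEcard subsetIr (eqP (valP A)) andTb.
      have := cardsID (val A) (h @: block t T).
      rewrite card_imset // (card_block sqg_t cT) => E.
      by rewrite -(leq_add2r #|(h @: block t T) :\: val A|) E -[3]/(2 + 1) leq_add2l.
    have /codom_sub[S cS EA] : val A \subset codom h.
      by apply: (subset_trans AT); apply/subsetP=> _ /imsetP[x _ ->]; apply: codom_f.
    rewrite (block_colorE EA) (block_uniq sqg_t cT cS) //.
    by apply/subsetP=> x xS; rewrite -(mem_imset _ _ h_inj) (subsetP AT) // EA imset_f.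
  case/card_gt1P=> _ [_ [/setDP[/imsetP[x xT ->] xA] /setDP[/imsetP[y yT ->] yA] xy]].
  have [B' EB'] := edgeP xy; have EB'h : val B' = h @: [set x; y].
    by rewrite EB' imsetU !imset_set1.
  exists B'.
    rewrite (block_colorE EB'h) (block_uniq sqg_t cT) // ?subUset ?sub1set ?xT //.
    by rewrite -(card_imset _ h_inj) -EB'h (eqP (valP B')).
  rewrite -setI_eq0 EB'; apply/eqP/setP=> i; rewrite !inE.
  by apply/negP=> /andP[iA /orP[]/eqP E]; rewrite -E iA in xA yA.
rewrite (block_color0 pB ph).
have [|/subsetPn[i iA ih]] := boolP (val A \subset codom h); last first.
  by rewrite (block_color0 iA ih).
move=> Ah _; have [S cS EA] := codom_sub Ah.
have /properP[_ [z zS zNS]] : S \proper block t S.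
  by rewrite properEcard sub_block // cS (card_block sqg_t cS).
have zp : h z != p by apply: contraNneq ph => <-; apply: codom_f.
have [B' EB'] := edgeP zp; exists B'.
  by apply: (@block_color0 _ p); rewrite ?EB' ?inE ?eqxx ?orbT.
rewrite -setI_eq0 EB'; apply/eqP/setP=> i; rewrite !inE.
apply/negP=> /andP[iA /orP[]/eqP E].
  by move: iA; rewrite E EA mem_imset // (negPf zNS).
by move: ph; rewrite -E (subsetP Ah).
Qed.

Lemma Fall_of_steiner : exists k, Fall (kneser n 2) k.
Proof. exact: Fall_of_fibers block_color_meet block_color_dom. Qed.

End BlockColoring.

(** * The Bose-Skolem product *)

(** The point at infinity of Skolem's construction is [None]. Over a commutative
    quasigroup [Q] with left division [ld], the blocks on [option (Q * 'I_3)] are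
    - {(x,i), (y,i), (op x y, i+1)} for x <> y;
    - {(x,0), (x,1), (x,2)} for x idempotent;
    - {oo, (x,i), (op x x, i+1)} for x not idempotent.
    The second and third kinds cover the pairs {(x,i), (op x x, i+1)}, to which
    the first kind would assign a degenerate block. The map [s] inverts squaring
    from non-idempotent to idempotent elements; it locates the block through oo
    and (x,i) when x is idempotent. *)
Section TripleSystem.
Variables (Q : finType) (op ld : Q -> Q -> Q) (s : Q -> Q).
Hypotheses (opC : commutative op) (opK : forall x, cancel (op x) (ld x))
  (ldK : forall x, cancel (ld x) (op x)).
Hypothesis nonidem : forall x, op x x != x ->
  op (op x x) (op x x) = op x x /\ s (op x x) = x.
Implicit Types (x y z : Q) (i j : 'I_3).
Import GRing.Theory.
Local Open Scope ring_scope.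

(** The third point of the block through (x,i) and (y,i+1). *)
Definition third_cross x y i : option (Q * 'I_3) :=
  if ld x y != x then Some (ld x y, i)
  else if x == y then Some (x, i - 1) else None.

(** The third point of the block through infinity and (x,i). *)
Definition third_infty x i : option (Q * 'I_3) :=
  if op x x == x then Some (s x, i - 1) else Some (op x x, i + 1).

Definition third (a b : option (Q * 'I_3)) : option (Q * 'I_3) :=
  match a, b with
  | None, None => None
  | None, Some (x, i) | Some (x, i), None => third_infty x i
  | Some (x, i), Some (y, j) =>
      if i == j then (if x == y then Some (x, i) else Some (op x y, i + 1))
      else if j == i + 1 then third_cross x y i else third_cross y x j
  end.

Lemma I3_cases i j : [\/ j = i, j = i + 1 | i = j + 1].
Proof.
case: i j => [[|[|[|]]]//= ?] [[|[|[|]]]//= ?];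
   solve [constructor 1; exact: val_inj | constructor 2; exact: val_inj
        | constructor 3; exact: val_inj].
Qed.

Lemma I3_succ_neq i : (i + 1 == i) = false.
Proof. by case: i => [[|[|[|]]]//= ?]. Qed.

Lemma I3_pred_neq i : (i - 1 == i) = false.
Proof. by case: i => [[|[|[|]]]//= ?]. Qed.

Lemma I3_succ2 i : i + 1 + 1 = i - 1.
Proof. by case: i => [[|[|[|]]]//= ?]; apply: val_inj. Qed.

Lemma I3_succ_pred i : i + 1 = i - 1 - 1.
Proof. by case: i => [[|[|[|]]]//= ?]; apply: val_inj. Qed.

Lemma third_same x y i : x != y ->
  third (Some (x, i)) (Some (y, i)) = Some (op x y, i + 1).
Proof. by move=> /negPf /= ->; rewrite eqxx. Qed.

Lemma third_succ x y i : third (Some (x, i)) (Some (y, i + 1)) = third_cross x y i.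
Proof. by rewrite /= eq_sym I3_succ_neq eqxx. Qed.

Lemma third_pred x y i : third (Some (y, i + 1)) (Some (x, i)) = third_cross x y i.
Proof. by rewrite /= I3_succ_neq eq_sym I3_succ2 I3_pred_neq. Qed.

Lemma thirdC : commutative third.
Proof.
move=> [[x i]|] [[y j]|] //; have [->|->|->] := I3_cases i j.
- by rewrite /= eqxx; have [->|xy] := eqVneq x y; rewrite // opC.
- by rewrite third_succ third_pred.
- by rewrite third_succ third_pred.
Qed.

Lemma third_idem : idempotent_op third.
Proof. by move=> [[x i]|] //=; rewrite !eqxx. Qed.

Lemma ld_eq x y z : (ld x y == z) = (op x z == y).
Proof. by apply/eqP/eqP => <-; rewrite ?opK ?ldK. Qed.

Lemma third_cross_op x z i : z != x -> third_cross x (op x z) i = Some (z, i).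
Proof. by rewrite /third_cross opK => ->. Qed.

Lemma third_cross_idem x i : op x x = x -> third_cross x x i = Some (x, i - 1).
Proof. by move=> xx; rewrite /third_cross ld_eq xx !eqxx. Qed.

Lemma third_cross_nonidem x i : op x x != x -> third_cross x (op x x) i = None.
Proof. by rewrite eq_sym /third_cross opK eqxx => /negPf->. Qed.

(** One case for each kind of block, with y expressed through [op] so that the
    product of (x,i) with the third point can be computed. *)
Variant cross_spec x y i : option (Q * 'I_3) -> Prop :=
 | CrossGeneric z of z != x & y = op x z : cross_spec x y i (Some (z, i))
 | CrossIdem of op x x = x & y = x : cross_spec x y i (Some (x, i - 1))
 | CrossInfty of op x x != x & y = op x x : cross_spec x y i None.

Lemma third_crossP x y i : cross_spec x y i (third_cross x y i).
Proof.
rewrite -(ldK x y); have [->|zx] := eqVneq (ld x y) x; last first.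
  by rewrite third_cross_op //; constructor.
have [xx|xx] := eqVneq (op x x) x; last by rewrite third_cross_nonidem //; constructor.
by rewrite {2}xx third_cross_idem //; constructor.
Qed.

(** The three kinds of position of two finite points are handled separately: in
    each, the third point lies in a position relative to (x,i) whose block is
    the same one, by the cancellation laws of [op] and [ld] or, when the third
    point is infinity, by the choice of [s]. *)
Lemma thirdK_points (a b : Q * 'I_3) : third (Some a) (third (Some a) (Some b)) = Some b.
Proof.
move: a b => [x i] [y j].
  have [->|->|->] := I3_cases i j.
  - have [->|xy] := eqVneq x y; first by rewrite !third_idem.
    by rewrite third_same // third_succ third_cross_op // eq_sym.
  - rewrite third_succ; case: third_crossP => [z zx ->|xx ->|xx ->].
    + by rewrite third_same // eq_sym.
    + rewrite -{1}(subrK 1 i) third_pred third_cross_idem //.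
      by rewrite -I3_succ_pred.
    + by rewrite /= /third_infty (negPf xx).
  - rewrite third_pred; case: third_crossP => [z zy ->|yy ->|yy ->].
    + by rewrite third_pred opC third_cross_op // eq_sym.
    + by rewrite -I3_succ2 third_succ third_cross_idem // addrK.
    + by have [xx sx] := nonidem yy; rewrite /= /third_infty xx eqxx sx addrK.
Qed.

(** Skolem's case: squaring is a bijection from the non-idempotent elements to
    the idempotent ones, so the pairs {oo, (x,i)} are covered exactly once. *)
Lemma third_steiner :
  (forall x, op x x = x -> op (s x) (s x) = x /\ s x != x) ->
  steiner_quasigroup third.
Proof.
move=> idem; split; [exact: thirdC | exact: third_idem | move=> [[x i]|] [[y j]|] //].
- exact: thirdK_points.
- rewrite {2}/third /third_infty; have [/idem[sxx sx]|xx] := eqVneq (op x x) x.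
    rewrite -{1}(subrK 1 i) third_pred -[X in third_cross _ X]sxx.
    by rewrite third_cross_nonidem // sxx eq_sym.
  by rewrite third_succ third_cross_nonidem.
- rewrite {2}/third /third_infty.
  have [/idem[sxx sx]|/nonidem[xx sx]] := eqVneq (op y y) y.
    by rewrite /= /third_infty sxx eq_sym (negPf sx) subrK.
  by rewrite /= /third_infty xx eqxx sx addrK.
Qed.

(** Bose's case: when every element is idempotent no block of two finite points
    contains infinity, and the point at infinity can be removed. *)
Lemma third_restrict_steiner : (forall x, op x x = x) ->
  exists t : Q * 'I_3 -> Q * 'I_3 -> Q * 'I_3, steiner_quasigroup t.
Proof.
move=> idem; pose t (a b : Q * 'I_3) := odflt a (third (Some a) (Some b)).
have thirdS a b : Some (t a b) = third (Some a) (Some b).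
  have crossS x y i : isSome (third_cross x y i).
    by rewrite /third_cross ld_eq idem; case: ifP => // /negbFE/eqP->; rewrite eqxx.
  move: a b => [x i] [y j]; have : isSome (third (Some (x, i)) (Some (y, j))).
    by rewrite /=; do ![case: ifP => _ //].
  by rewrite /t; case: (third _ _).
exists t; split=> [a b|a|a b]; apply: (@Some_inj); rewrite !thirdS.
- exact: thirdC.
- exact: third_idem.
- exact: thirdK_points.
Qed.

End TripleSystem.

(** * Steiner triple systems of orders 1 and 3 modulo 6 *)

Section Constructions.
Import GRing.Theory.
Local Open Scope ring_scope.

(** In Z/(2m+1) the mean (x + y)/2, with 1/2 = m + 1, is an idempotent
    commutative quasigroup operation. *)
Lemma bose_steiner m : exists (P : finType) (t : P -> P -> P),
  #|P| = (6 * m + 3)%N /\ steiner_quasigroup t.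
Proof.
pose Q := 'I_(m.*2).+1; pose op (x y : Q) := (x + y) *+ m.+1.
pose ld (x y : Q) := y *+ 2 - x.
have dbl (x : Q) : x *+ 2 *+ m.+1 = x.
  have ch : x *+ (m.*2).+1 = 0 by rewrite Zp_mulrn; apply: val_inj; rewrite /= modnMl.
  by rewrite -mulrnA mul2n doubleS mulrS ch addr0.
have opC : commutative op by move=> x y; rewrite /op addrC.
have opK x : cancel (op x) (ld x).
  by move=> y; rewrite /ld /op mulrnAC dbl addrC addKr.
have ldK x : cancel (ld x) (op x) by move=> y; rewrite /ld /op addrC subrK dbl.
have idem x : op x x = x by rewrite /op -mulr2n dbl.
have [|t sqg_t] := @third_restrict_steiner Q op ld id opC opK ldK _ idem.
  by move=> x; rewrite idem eqxx.
exists (Q * 'I_3)%type, t; split=> //; by rewrite card_prod !card_ord; lia.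
Qed.

(** In Z/(2M), with M = m + 1, relabel the sum x + y by the permutation [sg] that
    sends 2j to j and 2j + 1 to M + j. Then x < M is idempotent, and M + x has
    square x; so [s] is the translation by M. *)
Lemma skolem_steiner m : exists (P : finType) (t : P -> P -> P),
  #|P| = (6 * m.+1 + 1)%N /\ steiner_quasigroup t.
Proof.
pose Q := 'I_(m.*2).+2.
pose sg (z : Q) : Q := inord (z./2 + odd z * m.+1).
pose ta (z : Q) : Q := if z <= m then inord z.*2 else inord (z - m.+1).*2.+1.
pose op (x y : Q) := sg (x + y); pose ld (x y : Q) := ta y - x.
have ltQ (z : Q) : z < m.*2.+2 by [].
have sgE z : sg z = (z./2 + odd z * m.+1)%N :> nat.
  by rewrite inordK //; have := ltQ z; lia.
have taE z : ta z = (if z <= m then z.*2 else (z - m.+1).*2.+1)%N :> nat.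
  by rewrite /ta; have := ltQ z; case: ifP => ? ?; rewrite inordK //; lia.
have taK : cancel ta sg.
  by move=> z; apply: val_inj; rewrite /= sgE taE; have := ltQ z; case: ifP; lia.
have sgK : cancel sg ta.
  by move=> z; apply: val_inj; rewrite /= taE sgE; have := ltQ z; case: ifP; lia.
have opC : commutative op by move=> x y; rewrite /op addrC.
have opK x : cancel (op x) (ld x).
  by move=> y; rewrite /ld /op sgK addrC addKr.
have ldK x : cancel (ld x) (op x) by move=> y; rewrite /ld /op addrC subrK taK.
pose s (x : Q) : Q := if x <= m then inord (x + m.+1) else inord (x - m.+1).
have sE x : s x = (if x <= m then x + m.+1 else x - m.+1)%N :> nat.
  by rewrite /s; have := ltQ x; case: ifP => ? ?; rewrite inordK //; lia.
have opxxE x : op x x = (if x <= m then x : nat else x - m.+1)%N :> nat.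
  rewrite /op sgE /=; have xQ := ltQ x; case: (leqP x m) => xm.
    by rewrite modn_small; lia.
  have -> : (x + x = (x + x - m.*2.+2) + m.*2.+2)%N by lia.
  by rewrite modnDr modn_small; lia.
exists (option (Q * 'I_3)); eexists; split; last first.
  apply: (@third_steiner Q op ld s) => // x; have := ltQ x.
    have ifN (T : Type) (a b : T) : m < x -> (if x <= m then a else b) = b.
      by rewrite ltnNge => /negPf->.
    move=> xQ; rewrite -val_eqE /= opxxE; case: (leqP x m) => xm; first by rewrite eqxx.
    move=> _; have xm' : x - m.+1 <= m by lia.
    by split; apply: val_inj; rewrite /= ?sE !opxxE !ifN // xm'; lia.
  move=> xQ /(congr1 val) /=; rewrite opxxE; case: leqP => xm E; last by lia.
  split; [apply: val_inj | apply/eqP => /(congr1 val)];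
    rewrite /= ?opxxE !sE xm; last by lia.
  by case: leqP; lia.
by rewrite card_option card_prod !card_ord; lia.
Qed.

Lemma steiner_exists n : n = 1 %[mod 6] \/ n = 3 %[mod 6] ->
  exists (P : finType) (t : P -> P -> P), #|P| = n /\ steiner_quasigroup t.
Proof.
case=> n6.
  have [n1|n1] := leqP n 1.
    exists unit, (fun _ _ => tt); rewrite card_unit; split; first by lia.
    by split=> [[] []|[]|[] []].
  have -> : n = (6 * (n %/ 6).-1.+1 + 1)%N by lia.
  exact: skolem_steiner.
have -> : n = (6 * (n %/ 6) + 3)%N by lia.
exact: bose_steiner.
Qed.

End Constructions.

(** * The theorem *)

(** With n = m there is no star, and with n = m + 1 there is one. *)
Lemma Fall_nonempty n m : m = 1 %[mod 6] \/ m = 3 %[mod 6] -> m <= n <= m.+1 ->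
  exists k, Fall (kneser n 2) k.
Proof.
move=> /steiner_exists[P [t [cP sqg_t]]] /andP[mn nm]; rewrite -cP in mn nm.
apply: (Fall_of_steiner sqg_t (h := widen_ord mn \o enum_rank)) => //.
by move=> x y /(congr1 val)/= /val_inj /enum_rank_inj.
Qed.

Lemma Fall_count n k : 2 <= n -> Fall (kneser n 2) k ->
  (odd n /\ 6 * k = n * n.-1) \/ (~~ odd n /\ 6 * k.-1 = n.-1 * n.-2 /\ 0 < k).
Proof. by move=> n2 [C [f [<- fall_f]]]; apply: fall_color_count fall_f. Qed.

Lemma Fall_odd n k : 2 <= n -> n = 1 %[mod 6] \/ n = 3 %[mod 6] ->
  Fall (kneser n 2) k <-> k = (n * (n - 1)) %/ 6.
Proof.
move=> n2 n6.
have uniq_k l : Fall (kneser n 2) l -> l = (n * (n - 1)) %/ 6.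
  case/Fall_count=> // -[on]; last by lia.
  by rewrite subn1 => <-; rewrite mulKn.
split=> [/uniq_k //|->].
have [||l Fl] := @Fall_nonempty n n => //; first by rewrite leqnn leqnSn.
by rewrite -(uniq_k l Fl).
Qed.

Lemma Fall_even n k : 2 <= n -> n = 2 %[mod 6] \/ n = 4 %[mod 6] ->
  Fall (kneser n 2) k <-> k = ((n - 1) * (n - 2)) %/ 6 + 1.
Proof.
move=> n2 n6.
have uniq_k l : Fall (kneser n 2) l -> l = ((n - 1) * (n - 2)) %/ 6 + 1.
  case/Fall_count=> // -[on]; first by lia.
  by rewrite subn1 subn2 => -[<- l0]; rewrite mulKn // addn1 prednK.
split=> [/uniq_k //|->].
have [||l Fl] := @Fall_nonempty n n.-1; [by lia | by lia | ].
by rewrite -(uniq_k l Fl).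
Qed.

Lemma Fall_none n k : 2 <= n -> n = 0 %[mod 6] \/ n = 5 %[mod 6] ->
  ~ Fall (kneser n 2) k.
Proof.
move=> n2 n6 /Fall_count-/(_ n2).
have [q En] : exists q, n = 6 * q + 5 \/ n = 6 * q + 6 by exists (n.-1 %/ 6); lia.
(* In both cases the count equates a multiple of 6 with a product of factors
   congruent to 5 and 4. *)
have prod2 : (6 * q + 5) * (6 * q + 4) = 6 * (6 * (q * q) + 9 * q + 3) + 2 by lia.
case: En => -> [[on]|[on [+ _]]]; [|lia|lia|].
- by rewrite (_ : (6 * q + 5).-1 = 6 * q + 4) ?prod2; lia.
- rewrite (_ : (6 * q + 6).-1 = 6 * q + 5) ?(_ : (6 * q + 6).-2 = 6 * q + 4) ?prod2; lia.
Qed.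

From mathcomp Require Import classical_sets.

Theorem theorem1 (n : nat) (hn : 2 <= n) :
  [/\ n = 2 \/ n = 3 -> Fall (kneser n 2) = [set 1]%classic,
      n = 4 -> Fall (kneser n 2) = [set 2]%classic,
      5 <= n -> n = 1 %[mod 6] \/ n = 3 %[mod 6] ->
        Fall (kneser n 2) = [set (n * (n - 1)) %/ 6]%classic,
      5 <= n -> n = 2 %[mod 6] \/ n = 4 %[mod 6] ->
        Fall (kneser n 2) = [set ((n - 1) * (n - 2)) %/ 6 + 1]%classic
    & 5 <= n -> n = 0 %[mod 6] \/ n = 5 %[mod 6] ->
        Fall (kneser n 2) = set0%classic].
Proof.
have single p : (forall k, Fall (kneser n 2) k <-> k = p) ->
    Fall (kneser n 2) = [set p]%classic.
  by move=> Fp; apply/seteqP; split=> k /=; rewrite Fp.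
split=> [[En|En]|En|_ n6|_ n6|_ n6].
- by apply: single => k; rewrite Fall_even // En //; left.
- by apply: single => k; rewrite Fall_odd // En //; right.
- by apply: single => k; rewrite Fall_even // En //; right.
- by apply: single => k; apply: Fall_odd.
- by apply: single => k; apply: Fall_even.
- by apply/seteqP; split=> k // /(Fall_none hn n6).
Qed.
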